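(* Let $B$ be a $0$-$1$ stationary simple Bratteli diagram with edge set $E$ and path space $X_B$. Let $m$ be a Borel probability measure on $X_B$ which is either the unique $\mathcal R$-invariant probability measure $\mu$, or a stationary Markov measure $\nu$ of full support, or a quasi-stationary Markov measure. Then the collection of maps $\{\sigma_e:D_e\to R_e\}_{e\in E}$, where $$D_e=\{y=(y_i)\in X_B: s(y_1)=r(e)\},\quad R_e=\{y=(y_i)\in X_B:y_1=e\},\quad \sigma_e(y)=(y'_0,e,y_1,y_2,\ldots)$$ (with $y'_0$ the unique edge from $v_0$ to $s(e)$), forms a saturated semibranching function system on $(X_B,m)$ satisfying condition (C-K).
   Context: $0$-$1$ stationary simple Bratteli diagram. $V$ is a finite set, $A=(a_{i,j})_{i,j\in V}$ is a primitive $0$-$1$ matrix, and $E$ is the set of edges: there is exactly one edge $e\in E$ with source $s(e)=i$ and range $r(e)=j$ if $a_{i,j}=1$, and none otherwise. The diagram $B$ has top level $V_0=\{v_0\}$, all levels $V_n$ ($n\ge1$) are copies of $V$, there is exactly one edge from $v_0$ to each vertex of $V_1$, and the edges between $V_n$ and $V_{n+1}$ ($n\ge1$) are a copy of $E$. $X_B$ is the set of infinite paths $x=(x_0,x_1,x_2,\ldots)$, $x_0$ an edge from $v_0$, $x_i\in E$ for $i\ge1$, with $r(x_i)=s(x_{i+1})$ for all $i\geq 0$; $X_B$ carries the topology generated by the cylinder sets $[(e_0,\ldots,e_n)]=\{x:x_i=e_i,\ 0\le i\le n\}$ and is assumed to be a Cantor set. All measures are assumed Borel and non-atomic. $\mathcal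 R$-invariant measure: $\mathcal R$ is the tail equivalence relation on $X_B$; a measure is $\mathcal R$-invariant if any two cylinder sets of the same length ending at the same vertex have equal measure. For a $0$-$1$ stationary simple Bratteli diagram $B$ with primitive $0$-$1$ matrix $A$ there is a unique $\mathcal R$-invariant probability measure $\mu$: $\mu([(e_0,\ldots,e_n)])=\mathbf x_{r(e_n)}\lambda^{-n}$, where $\lambda$ is the Perron-Frobenius eigenvalue of $A$ and $\mathbf x$ the positive eigenvector, $A\mathbf x=\lambda\mathbf x$, $\sum_i\mathbf x_i=1$. Markov measure: given a row vector $P_0=(p^{(0)}_{v_0,e})$ indexed by edges $e$ from $v_0$ and matrices $P_n=(p^{(n)}_{v,e})_{v\in V,e\in E}$, $n\ge1$, with $p^{(n)}_{v,e}>0\iff s(e)=v$ and $\sum_{e:s(e)=v}p^{(n)}_{v,e}=1$ for all $v$ (for all $n\ge0$), the Markov measure $m=m(P_n)$ is given by $m([(e_0,\ldots,e_n)])=p^{(0)}_{v_0,e_0}p^{(1)}_{s(e_1),e_1}\cdots p^{(n)}_{s(e_n),e_n}$. It is stationary if $P_n=P$ for all $n\ge1$. It is quasi-stationary if $0<\prod_{i=1}^\infty \frac{p^{(i+1)}_{s(x_i),x_i}}{p^{(i)}_{s(x_i),x_i}}<\infty$ for every $x=(x_i)\in X_B$. Semibranching function system (s.f.s.). A finite family $\{\sigma_i:i\in\Lambda\}$ of one-to-one measurable maps $\sigma_i$, each defined on $D_i\subset X$ with $R_i=\sigma_i(D_i)$, on a probability space $(X,m)$ with $m$ non-atomic, is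 an s.f.s. if: (i) $m(R_i\cap R_j)=0$ for $i\ne j$ and $m(X\setminus\bigcup_i R_i)=0$; (ii) $m\circ\sigma_i\ll m$ on $D_i$ (where $(m\circ\sigma_i)(C)=m(\sigma_i(C))$) and $\frac{d\,m\circ\sigma_i}{dm}(x)>0$ for $m$-a.e. $x\in D_i$; (iii) there is a measurable map $\sigma:X\to X$ (coding map) with $\sigma\circ\sigma_i(x)=x$ for $m$-a.e. $x\in D_i$, $i\in\Lambda$. It is saturated if $\bigcup_i D_i=X$ a.e. It satisfies condition (C-K) if for each $i$ there is $\Lambda_i\subset\Lambda$ with $D_i=\bigcup_{j\in\Lambda_i}R_j$ up to a null set. *)

(* Defs.v *)
From HB Require Import structures.
From mathcomp Require Import all_boot all_order all_algebra.
From mathcomp Require Import all_classical all_reals all_analysis.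

Set Implicit Arguments.
Unset Strict Implicit.
Unset Printing Implicit Defensive.

Import Order.TTheory GRing.Theory Num.Theory.
Import numFieldNormedType.Exports.

Local Open Scope classical_set_scope.
Local Open Scope ring_scope.

(* A 0-1 matrix indexed by V is a boolean relation; MathComp matrices are
   indexed by ordinals, hence the enumeration of V. *)
Definition adjmx (V : finType) (A : rel V) : 'M[nat]_#|V| :=
  \matrix_(i, j) nat_of_bool (A (enum_val i) (enum_val j)).

Definition primitive01 (V : finType) (A : rel V) : Prop :=
  exists2 k, (0 < k)%N & forall i j, (0 < (adjmx A ^+ k) i j)%N.

(* V is required to be inhabited because otherwise the path space is empty. *)
Record bratteli := Bratteli {
  vert : finType;
  adj : rel vert;
  vert_inhabited : inhabited vert;
  adj_primitive : primitive01 adj }.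

Section Diagram.
Variable B : bratteli.
Local Notation V := (vert B).

Definition edge : Type := {p : V * V | adj p.1 p.2}.
HB.instance Definition _ := Finite.on edge.

Definition src (e : edge) : V := (val e).1.
Definition rng (e : edge) : V := (val e).2.

(* The unique edge from v_0 to a vertex v of level 1 is represented by v.
   [pinit x] is x_0 and [ptail x n] is x_(n+1): ptail is indexed from 0. *)
Record bpath := BPath {
  pinit : V;
  ptail : nat -> edge;
  pcompat0 : pinit = src (ptail 0%N);
  pcompat : forall n, rng (ptail n) = src (ptail n.+1) }.

(* Finite paths (e_0, e_1, ..., e_n), with e_0 given by its range v. *)
Fixpoint fpath (v : V) (es : seq edge) : bool :=
  if es is e :: es' then (src e == v) && fpath (rng e) es' else true.

Definition fend (v : V) (es : seq edge) : V := last v (map rng es).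

Definition cylinder (v : V) (es : seq edge) : set bpath :=
  [set x | pinit x = v /\ mkseq (ptail x) (size es) = es].

Definition cylinders : set (set bpath) :=
  [set C | exists v es, fpath v es /\ C = cylinder v es].

Lemma out_edge (v : V) : exists e : edge, src e = v.
Proof.
have [[|k] // _ /(_ (enum_rank v) (enum_rank v))] := adj_primitive B.
rewrite exprS mxE => h.
have [j hj] : exists j, (0 < adjmx (@adj B) (enum_rank v) j)%N.
  apply/not_existsP => nj; move: h; rewrite big1 // => j _.
  have := nj j; case: (adjmx _ _ j) => [_|n /(_ isT)//]; exact: mul0n.
move: hj; rewrite mxE enum_rankK; case hA : adj => // _.
by exists (exist _ (v, enum_val j) hA).
Qed.

Lemma bpath_inhabited : inhabited bpath.
Proof.
have [v] := vert_inhabited B.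
pose nxt (w : V) := sval (cid (out_edge w)).
have nxtE w : src (nxt w) = w by rewrite /nxt; case: cid.
pose t := fix t n := if n is k.+1 then nxt (rng (t k)) else nxt v.
by apply: inhabits; apply: (@BPath v t) => [|n] /=; rewrite nxtE.
Qed.

HB.instance Definition _ := gen_eqMixin bpath.
HB.instance Definition _ := gen_choiceMixin bpath.
HB.instance Definition _ := isPointed.Build bpath (inhabited_witness bpath_inhabited).
HB.instance Definition _ :=
  @isSubBaseTopological.Build bpath (set bpath) cylinders id.

Local Notation borel_bpath := (g_sigma_algebraType (@open bpath)).

Definition Dom (e : edge) : set borel_bpath :=
  [set y : bpath | src (ptail y 0%N) = rng e].

Definition Ran (e : edge) : set borel_bpath :=
  [set y : bpath | ptail y 0%N = e].

Definition prepend (e : edge) (t : nat -> edge) (n : nat) : edge :=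
  if n is k.+1 then t k else e.

Lemma prepend_compat (e : edge) (y : bpath) :
  src (ptail y 0%N) = rng e ->
  forall n, rng (prepend e (ptail y) n) = src (prepend e (ptail y) n.+1).
Proof. by move=> h [|n] //=; exact: pcompat. Qed.

(* sigma_e; the value outside Dom e is a dummy. *)
Definition branch (e : edge) (y : borel_bpath) : borel_bpath :=
  match pselect (src (ptail (y : bpath) 0%N) = rng e) with
  | left h => @BPath (src e) (prepend e (ptail y)) erefl (prepend_compat h)
  | right _ => y
  end.

End Diagram.

Notation borel_bpath B := (g_sigma_algebraType (@open (bpath B))).

Definition cantor_set (T : topologicalType) : Prop :=
  exists (f : T -> cantor_space) (g : cantor_space -> T),
    [/\ cancel f g, cancel g f, continuous f & continuous g].

Section Measures.
Context (R : realType) (B : bratteli).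
Variable m : probability (borel_bpath B) R.
Local Notation V := (vert B).
Local Notation E := (edge B).

Definition R_invariant : Prop :=
  forall (v w : V) (es fs : seq E), fpath v es -> fpath w fs ->
    size es = size fs -> fend v es = fend w fs ->
    m (cylinder v es) = m (cylinder w fs).

(* P n is the matrix P_n for n >= 1 (P 0 is unused); P0 is the initial row
   vector, indexed by the edges from v_0, that is, by V. *)
Definition markov_data (P0 : V -> R) (P : nat -> V -> E -> R) : Prop :=
  [/\ forall v, 0 < P0 v,
      \sum_v P0 v = 1,
      forall n v e, (0 < n)%N -> 0 <= P n v e,
      forall n v e, (0 < n)%N -> (0 < P n v e <-> src e = v) &
      forall n v, (0 < n)%N -> \sum_(e : E | src e == v) P n v e = 1].

Definition markov_measure (P0 : V -> R) (P : nat -> V -> E -> R) : Prop :=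
  markov_data P0 P /\
  forall (v : V) (n : nat) (es : n.-tuple E), fpath v es ->
    m (cylinder v es) =
    (P0 v * \prod_(i < n) P i.+1 (src (tnth es i)) (tnth es i))%:E.

Definition stationary_markov : Prop :=
  exists P0 P, markov_measure P0 P /\ forall n, (0 < n)%N -> P n = P 1%N.

(* The factor of index i is the ratio of the entries of P_(i+2) and P_(i+1)
   at x_(i+1). *)
Definition quasi_stationary_markov : Prop :=
  exists P0 P, markov_measure P0 P /\
    forall x : bpath B, exists2 l : R, 0 < l &
      (\prod_(i < n) (P i.+2 (src (ptail x i)) (ptail x i) /
                      P i.+1 (src (ptail x i)) (ptail x i))) @[n --> \oo] --> l.

Definition full_support : Prop :=
  forall U : set (bpath B), open U -> U !=set0 -> (0 < m U)%E.

End Measures.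

Section SemibranchingFunctionSystem.
Context d (T : measurableType d) (R : realType).
Variable m : probability T R.

Definition nonatomic : Prop :=
  forall A : set T, measurable A -> (0 < m A)%E ->
    exists C : set T, [/\ measurable C, C `<=` A, (0 < m C)%E & (m C < m A)%E].

Context (L : finType) (D Rg : L -> set T) (sigma : L -> T -> T).

(* sigma i is only meaningful on D i. In sfs_rn, nu is the measure m o sigma_i
   on D_i, extended by 0; sfs_image is what makes it well defined. *)
Record semibranching : Prop := {
  sfs_nonatomic : nonatomic;
  sfs_dom : forall i, measurable (D i);
  sfs_meas : forall i, measurable_fun (D i) (sigma i);
  sfs_inj : forall i, set_inj (D i) (sigma i);
  sfs_range : forall i, Rg i = sigma i @` D i;
  sfs_image : forall i C, measurable C -> C `<=` D i ->
    measurable (sigma i @` C);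
  sfs_disjoint : forall i j, i != j -> m (Rg i `&` Rg j) = 0%E;
  sfs_cover : m (~` (\bigcup_i Rg i)) = 0%E;
  sfs_rn : forall i, exists nu : {finite_measure set T -> \bar R},
    [/\ forall C, measurable C -> nu C = m (sigma i @` (C `&` D i)),
        nu `<< m &
        {ae m, forall x, D i x ->
           (0 < Radon_Nikodym (charge_of_finite_measure nu) m x)%E}];
  sfs_coding : exists2 c : T -> T, measurable_fun setT c &
    forall i, {ae m, forall x, D i x -> c (sigma i x) = x} }.

Definition saturated : Prop := m (~` (\bigcup_i D i)) = 0%E.

Definition condition_CK : Prop :=
  forall i, exists J : {set L},
    let U := \bigcup_(j in [set j | j \in J]) Rg j in
    m (D i `\` U) = 0%E /\ m (U `\` D i) = 0%E.

End SemibranchingFunctionSystem.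

(* Main.v *)
Require Import Defs.
From HB Require Import structures.
From mathcomp Require Import all_boot all_order all_algebra.
From mathcomp Require Import finmap ring.
From mathcomp Require Import all_classical all_reals all_analysis.

(** The measure [C |-> m (sigma_e C)] on [Dom e] and [m] itself are compared on
    the classes [pclass n x] of paths sharing with [x] the vertex of level 1
    and the first [n] edges.  If [nu (pclass n x) <= K m (pclass n x)] for all
    [n], with [K] depending on [x], then [nu << m]: on the set [A_K] of points
    where a fixed [K] works, the inequality passes from unions of classes to
    all Borel sets by approximation.  Applied in both directions this yields
    absolute continuity and a positive density.  For a Markov measure the ratio
    of the two values is a constant times a partial product of the
    quasi-stationarity product, hence bounded away from [0] and [+oo].  For an
    R-invariant measure the values on classes are weights [w_n(v)] of the end
    vertex with [w_n = A w_(n+1)], and positivity of a power of [A] makes all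
    weights of levels [n] and [n+1] uniformly comparable, without appeal to the
    Perron-Frobenius theorem. *)

Set Implicit Arguments.
Unset Strict Implicit.
Unset Printing Implicit Defensive.

Import Order.TTheory GRing.Theory Num.Theory.
Import numFieldNormedType.Exports.

Local Open Scope classical_set_scope.
Local Open Scope ring_scope.

(** * Finite prefixes of paths and the Borel structure they generate *)

Section Prefixes.
Context {B : bratteli}.
Local Notation V := (vert B).
Local Notation E := (edge B).
Local Notation X := (borel_bpath B).
Implicit Types (x y : bpath B) (Q : set X).

Lemma bpath_eq x y : pinit x = pinit y -> ptail x =1 ptail y -> x = y.
Proof.
case: x y => [v t h0 h] [w s k0 k] /= vw /funext ts.
move: h0 h; rewrite vw ts => h0 h.
by rewrite (Prop_irrelevance h0 k0) (Prop_irrelevance h k).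

Qed.

(** The values lie in a finite type, so there are finitely many classes for each [n], and sums over
    them are finite. *)
Definition pfx n x : V * n.-tuple E := (pinit x, [tuple ptail x i | i < n]).

Definition pclass n x : set X := [set y | pfx n y = pfx n x].

Lemma pfxP n x y : pfx n x = pfx n y <->
  pinit x = pinit y /\ forall i, (i < n)%N -> ptail x i = ptail y i.
Proof.
split=> [xy|[xy1 xy2]].
  split=> [|i ni]; first exact: (congr1 fst xy).
  have := congr1 (fun t => tnth t.2 (Ordinal ni)) xy.
  by rewrite !tnth_mktuple.
by congr pair => //; apply: eq_from_tnth => i; rewrite !tnth_mktuple xy2.
Qed.

Lemma pfx_le n p x y : (n <= p)%N -> pfx p x = pfx p y -> pfx n x = pfx n y.
Proof.
by move=> np /pfxP[xy1 xy2]; apply/pfxP; split=> // i /leq_trans/(_ np)/xy2.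
Qed.

Lemma pfx_mkseq n x : (pfx n x).2 = mkseq (ptail x) n :> seq E.
Proof.
apply: (@eq_from_nth _ (ptail x 0%N)); first by rewrite size_mkseq size_tuple.
move=> i; rewrite size_tuple => ni.
rewrite nth_mkseq// (nth_map (Ordinal ni)) ?size_enum_ord//.
by rewrite nth_enum_ord.
Qed.

Lemma cylinder_pclass n x : cylinder (pinit x) (pfx n x).2 = pclass n x.
Proof.
rewrite pfx_mkseq /cylinder /pclass size_mkseq.
apply/seteqP; split=> y /=.
  move=> [y1 y2]; apply/pfxP; split=> // i ni.
  by have := congr1 (fun s => nth (ptail x 0%N) s i) y2; rewrite !nth_mkseq.
move=> /pfxP[y1 y2]; split=> //; apply/eq_in_map => i.
by rewrite mem_iota add0n => /y2.
Qed.

Lemma fpath_mkseq x n k :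
  Defs.fpath (src (ptail x k)) (map (ptail x) (iota k n)).
Proof.
elim: n k => // n IH k /=; rewrite eqxx/=.
by rewrite pcompat; exact: IH.
Qed.

Lemma fpath_pfx n x : Defs.fpath (pinit x) (pfx n x).2.
Proof. by rewrite pfx_mkseq (pcompat0 x); exact: fpath_mkseq. Qed.

Lemma open_pclass n x : open (pclass n x : set (bpath B)).
Proof.
exists [set pclass n x]; last by rewrite bigcup_set1.
move=> _ ->; exists [fset pclass n x]%fset; last first.
  by rewrite set_fset1 bigcap_set1.
move=> C; rewrite in_fset1 => /eqP ->; rewrite inE /=.
exists (pinit x), (pfx n x).2; split; first exact: fpath_pfx.
by rewrite cylinder_pclass.
Qed.

Lemma measurable_pclass n x : measurable (pclass n x).
Proof. by apply: sub_sigma_algebra; exact: open_pclass. Qed.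

(** Such sets are the finite unions of classes [pclass n x]. For varying [n] they form an algebra
    generating the Borel sets. *)
Definition determined n Q := forall x y, pfx n x = pfx n y -> Q x -> Q y.

Lemma determinedC n Q : determined n Q -> determined n (~` Q).
Proof. by move=> dQ x y xy nQx /(dQ y x (esym xy)). Qed.

Lemma determinedU n p Q Q' : determined n Q -> determined p Q' ->
  determined (maxn n p) (Q `|` Q').
Proof.
move=> dQ dQ' x y xy [Qx|Q'x]; [left|right].
  by apply: dQ Qx; exact: pfx_le (leq_maxl _ _) xy.
by apply: dQ' Q'x; exact: pfx_le (leq_maxr _ _) xy.
Qed.

Lemma determined_bigcup n Q : determined n Q ->
  Q = \bigcup_(s in [set pfx n x | x in Q]) (pfx n @^-1` [set s]).
Proof.
move=> dQ; apply/seteqP; split=> [x Qx|x [_ [y Qy <-]] /= xy].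
  by exists (pfx n x) => //; exists x.
exact: dQ (esym xy) Qy.
Qed.

Lemma finite_pfx n (S : set (V * n.-tuple E)) : finite_set S.
Proof. exact: finite_finset. Qed.

Lemma measurable_determined n Q : determined n Q -> measurable Q.
Proof.
move=> /determined_bigcup ->; apply: fin_bigcup_measurable.
  exact: finite_pfx.
by move=> _ [x _ <-]; exact: measurable_pclass.
Qed.

Lemma cylinder_determined v (es : seq E) : determined (size es) (cylinder v es).
Proof.
move=> x y /pfxP[xy1 xy2] [x1 x2]; split; first by rewrite -xy1.
rewrite -x2 /mkseq size_map size_iota; apply/eq_in_map => i.
by rewrite mem_iota add0n => /xy2.
Qed.

(** Around [x], an open set contains a finite intersection of cylinders through [x]; the longest of
    them gives a sufficient prefix length. *)
Lemma open_pclass_sub (U : set (bpath B)) x : open U -> U x ->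
  exists n, pclass n x `<=` U.
Proof.
move=> [D' D'fin <-] [C D'C Cx].
have [F Fcyl FC] := D'fin _ D'C.
(* [N A] is the length of the cylinder [A], with the dummy value 0 for sets outside the family
   [F]. *)
have /choice[N HN] (A : set (bpath B)) :
    exists n, A \in F -> pclass n x `<=` A.
  case: (boolP (A \in F)) => AF; last by exists 0%N.
  have := Fcyl _ AF; rewrite inE => -[v [es [_ AE]]].
  exists (size es) => _ y yx.
  have Ax : cylinder v es x by rewrite -AE; move: Cx; rewrite -FC; apply.
  rewrite AE; exact: cylinder_determined (esym yx) Ax.
exists (\max_(A <- F) N A) => y yx; exists C => //; change (C y).
rewrite -FC => A AF.
apply: (HN A) => //; apply: pfx_le yx.
by rewrite (big_rem A)//= leq_maxl.
Qed.

(** An open set [U] is the countable union over [n] of the points whose class of length [n] lies in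
    [U], and each of these sets is determined by prefixes. Closure under complements and countable
    unions then reaches all Borel sets. *)
Lemma borel_ind (P : set (set X)) :
  (forall n Q, determined n Q -> P Q) ->
  (forall C, P C -> P (~` C)) ->
  (forall F : nat -> set X, (forall n, P (F n)) -> P (\bigcup_n F n)) ->
  forall C, measurable C -> P C.
Proof.
move=> Pd PC PU; apply: smallest_sub.
  split=> //; first by apply: (Pd 0%N).
  by move=> A PA; rewrite setTD; exact: PC.
move=> U oU.
have -> : U = \bigcup_n [set x : X | pclass n x `<=` U].
  apply/seteqP; split=> [x /(open_pclass_sub oU)[n nU]|x [n _]]; last exact.
  by exists n.
apply: PU => n; apply: (Pd n) => x y xy xU z zy.
by apply: xU; rewrite /pclass /= xy.
Qed.

Lemma measurable_fun_determined (D : set X) (f : X -> X) : measurable D ->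
  (forall n Q, determined n Q -> measurable (D `&` f @^-1` Q)) ->
  measurable_fun D f.
Proof.
move=> mD mf _; apply: borel_ind => // [C IH|F IH]; last first.
  by rewrite preimage_bigcup setI_bigcupr; exact: bigcup_measurable.
rewrite preimage_setC -setDE.
have -> : D `\` f @^-1` C = D `\` (D `&` f @^-1` C).
  by rewrite setDIr setDv set0U.
exact: measurableD.
Qed.

End Prefixes.

(** * Approximation of Borel sets by sets determined by finite prefixes *)

Section Approximation.
Context {R : realType} {B : bratteli}.
Local Notation X := (borel_bpath B).
Implicit Types (x y : bpath B) (C Q : set X).
Local Open Scope ereal_scope.

Lemma measurableY C Q : measurable C -> measurable Q -> measurable (C `+` Q).
Proof.
by move=> mC mQ; rewrite setY_def; apply: measurableU; exact: measurableD.
Qed.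

(** Measurability is part of the property so that it is carried along by the induction over Borel
    sets. *)
Definition approximable (lam : set X -> \bar R) C := measurable C /\
  forall e : R, (0 < e)%R ->
    exists n Q, determined n Q /\ lam (C `+` Q) < e%:E.

Variable lam : {finite_measure set X -> \bar R}.

Lemma approximable_determined n Q : determined n Q -> approximable lam Q.
Proof.
move=> dQ; split=> [|e e0]; first exact: measurable_determined dQ.
by exists n, Q; rewrite setYK measure0 lte_fin.
Qed.

Lemma approximableC C : approximable lam C -> approximable lam (~` C).
Proof.
move=> [mC aC]; split=> [|e /aC[n [Q [dQ CQ]]]]; first exact: measurableC.
exists n, (~` Q); split; first exact: determinedC.
suff -> : ~` C `+` ~` Q = C `+` Q by [].
by rewrite !setY_def !setDE !setCK setUC (setIC Q) (setIC C) setUC setIC setUC.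
Qed.

(** Triangle inequality for the measure of the symmetric difference, with half of the error spent on
    each approximation. *)
Lemma approximable_trans C : measurable C ->
  (forall e : R, (0 < e)%R ->
    exists C', approximable lam C' /\ lam (C `+` C') < e%:E) ->
  approximable lam C.
Proof.
move=> mC aC; split=> // e e0.
have e20 : (0 < e / 2)%R by rewrite divr_gt0.
have [C' [[mC' aC'] CC']] := aC _ e20.
have [n [Q [dQ C'Q]]] := aC' _ e20.
have mQ := measurable_determined dQ.
exists n, Q; split=> //.
rewrite [e]splitr EFinD; apply: le_lt_trans (lteD CC' C'Q).
apply: le_trans (measureU2 _ _ _); [|exact: measurableY..].
apply: le_measure; rewrite ?inE; [exact: measurableY| |].
  by apply: measurableU; exact: measurableY.
rewrite !setY_def => z /=.
by have [] := pselect (C' z); tauto.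
Qed.

Lemma approximableU C C' : approximable lam C -> approximable lam C' ->
  approximable lam (C `|` C').
Proof.
move=> [mC aC] [mC' aC']; split=> [|e e0]; first exact: measurableU.
have e20 : (0 < e / 2)%R by rewrite divr_gt0.
have [n [Q [dQ CQ]]] := aC _ e20.
have [n' [Q' [dQ' CQ']]] := aC' _ e20.
have mQ := measurable_determined dQ; have mQ' := measurable_determined dQ'.
exists (maxn n n'), (Q `|` Q'); split; first exact: determinedU.
rewrite [e]splitr EFinD; apply: le_lt_trans (lteD CQ CQ').
apply: le_trans (measureU2 _ _ _); [|exact: measurableY..].
apply: le_measure; rewrite ?inE.
- by apply: measurableY; exact: measurableU.
- by apply: measurableU; exact: measurableY.
- by rewrite !setY_def => z /=; tauto.
Qed.

Lemma approximable_bigcup (F : nat -> set X) :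
  (forall n, approximable lam (F n)) -> approximable lam (\bigcup_n F n).
Proof.
move=> aF; have mF n : measurable (F n) by have [] := aF n.
pose G n := \big[setU/set0]_(i < n) F i.
have aG n : approximable lam (G n).
  rewrite /G; elim/big_ind : _ => //; last exact: approximableU.
  exact: (@approximable_determined 0).
have mG n : measurable (G n) by have [] := aG n.
have mU : measurable (\bigcup_n F n) by exact: bigcup_measurable.
apply: approximable_trans => // e e0.
(* The remainders after the partial unions [G n] decrease to the empty set, so finiteness of [lam]
   makes their measures tend to 0. *)
have : lam \o (fun n => \bigcup_n F n `\` G n) @ \oo -->
       lam (\bigcap_n (\bigcup_n F n `\` G n)).
  apply: nonincreasing_cvg_mu => //.
  - by rewrite ltey_eq fin_num_measure//; exact: measurableD.
  - by move=> n; exact: measurableD.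
  - by apply: bigcap_measurable => // n _; exact: measurableD.
  - move=> n p np; apply/subsetPset; apply: setDS.
    exact: subset_bigsetU.
have -> : \bigcap_n (\bigcup_n F n `\` G n) = set0.
  rewrite -subset0 => z /[dup] /(_ 0%N I)[[n _ Fn] _] /(_ n.+1 I)[_]; apply.
  by rewrite /G big_ord_recr/=; right.
rewrite measure0 => /fine_cvgP[_] /cvgr0Pnorm_lt /(_ _ e0).
move=> [N _ /(_ N (leqnn N))] /= GN.
exists (G N); split=> //.
have GF : G N `<=` \bigcup_n F n.
  by rewrite /G -bigcup_mkord => z [n _]; exists n.
have -> : \bigcup_n F n `+` G N = \bigcup_n F n `\` G N.
  by rewrite setY_def (_ : G N `\` _ = set0) ?setU0// setD_eq0.
rewrite -[ltLHS]fineK ?fin_num_measure//; last exact: measurableD.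
by rewrite lte_fin; apply: le_lt_trans GN; exact: ler_norm.
Qed.

Lemma borel_approximable C : measurable C -> approximable lam C.
Proof.
apply: borel_ind.
- exact: approximable_determined.
- exact: approximableC.
- exact: approximable_bigcup.
Qed.

End Approximation.

(** * Absolute continuity from bounds on prefix classes *)

Section AbsoluteContinuity.
Context {R : realType} {B : bratteli}.
Local Notation X := (borel_bpath B).
Implicit Types (x y : bpath B) (C Q A : set X).
Local Open Scope ereal_scope.
Variables mu nu : {finite_measure set X -> \bar R}.

Lemma determined_measure_le A n Q (K : R) : (0 <= K)%R -> measurable A ->
  (forall x, nu (pclass n x `&` A) <= K%:E * mu (pclass n x)) ->
  determined n Q -> nu (Q `&` A) <= K%:E * mu Q.
Proof.
move=> K0 mA nuA dQ.
rewrite (determined_bigcup dQ) setI_bigcupl.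
set S := [set pfx n x | x in Q].
have fS : finite_set S by exact: finite_pfx.
have tS : trivIset S (fun s => pfx n @^-1` [set s] : set X).
  by move=> s t _ _ [x [/= <- <-]].
have mS s : S s -> measurable (pfx n @^-1` [set s] : set X).
  by move=> [x _ <-]; exact: measurable_pclass.
rewrite !measure_fin_bigcup//; last 2 first.
- exact: trivIset_setIr.
- by move=> s Ss; apply: measurableI => //; exact: mS.
rewrite ge0_mule_fsumr; last by move=> s; exact: measure_ge0.
by apply: lee_fsum => // _ [x _ <-]; exact: nuA.
Qed.

(** Approximating with respect to the sum yields one set that is close to the given one for both
    measures. *)
Definition total_measure := measure_add mu nu.

HB.instance Definition _ := Measure.on total_measure.

Let total_measure_fin : fin_num_fun total_measure.
Proof.
move=> C mC; rewrite /total_measure measure_addE fin_numD.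
by rewrite !fin_num_measure.
Qed.

HB.instance Definition _ :=
  Measure_isFinite.Build _ _ _ total_measure total_measure_fin.

Lemma borel_measure_le A C (K : R) : (0 <= K)%R -> measurable A ->
  (forall n x, nu (pclass n x `&` A) <= K%:E * mu (pclass n x)) ->
  measurable C -> nu (C `&` A) <= K%:E * mu C.
Proof.
move=> K0 mA nuA mC; apply/lee_addgt0Pr => e e0.
(* The approximation error occurs once through [nu] and [K] times through [mu], so [e / (1 + K)] is
   the precision that adds up to [e]. *)
have K1 : (0 < 1 + K)%R by rewrite ltr_pwDl.
have [_ /(_ (e / (1 + K))%R)] := borel_approximable total_measure mC.
rewrite divr_gt0// => /(_ isT)[n [Q [dQ]]].
have mQ := measurable_determined dQ.
have mCQ := measurableY mC mQ.
rewrite /= /total_measure measure_addE => CQ.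
have muCQ : mu (C `+` Q) <= (e / (1 + K))%:E.
  by apply: le_trans (ltW CQ); rewrite leeDl.
have nuCQ : nu (C `+` Q) <= (e / (1 + K))%:E.
  by apply: le_trans (ltW CQ); rewrite leeDr.
have -> : e = (K * (e / (1 + K)) + e / (1 + K))%R.
  by rewrite -[X in (_ + X)%R]mul1r -mulrDl addrC mulrC divfK// gt_eqF.
rewrite EFinD EFinM addeA -ge0_muleDr//; last by rewrite lee_fin ltW// divr_gt0.
apply: (@le_trans _ _ (nu (Q `&` A) + nu (C `+` Q))).
  apply: le_trans (measureU2 _ _ _) => //; last exact: measurableI.
  apply: le_measure; rewrite ?inE; [exact: measurableI| |].
    by apply: measurableU => //; exact: measurableI.
  rewrite setY_def => z [Cz Az] /=.
  by have [] := pselect (Q z); tauto.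
apply: leeD => //.
apply: (@le_trans _ _ (K%:E * mu Q)); first exact: determined_measure_le dQ.
apply: lee_wpmul2l; first by rewrite lee_fin.
apply: le_trans (leeD (lexx _) muCQ).
apply: le_trans (measureU2 _ _ _) => //.
apply: le_measure; rewrite ?inE//; first exact: measurableU.
rewrite setY_def => z Qz /=.
by have [] := pselect (C z); tauto.
Qed.

Lemma dominates_pclass :
  (forall x, exists K : R, forall n,
    nu (pclass n x) <= K%:E * mu (pclass n x)) ->
  nu `<< mu.
Proof.
move=> nuK C C0 D mD DC.
have muD : mu D = 0 by exact: C0.
pose A (k : nat) : set X :=
  [set x | forall n, nu (pclass n x) <= k%:R%:E * mu (pclass n x)].
have dA k n :
    determined n [set x : X | nu (pclass n x) <= k%:R%:E * mu (pclass n x)].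
  by move=> x y xy /=; rewrite /pclass /= xy.
have mA k : measurable (A k).
  have -> : A k = \bigcap_n
      [set x : X | nu (pclass n x) <= k%:R%:E * mu (pclass n x)].
    by apply/seteqP; split=> x Ax n; [move=> _; exact: Ax|exact: (Ax n I)].
  by apply: bigcap_measurable => // n _; exact: measurable_determined.
have nuDA k : nu (D `&` A k) = 0.
  apply/eqP; rewrite -measure_le0 -(mule0 k%:R%:E) -muD.
  apply: borel_measure_le => // n x.
  (* A class meeting [A k] is also the class of a point [y] of [A k], where the bound holds by
     definition. *)
  have [->|/set0P[y [xy Ay]]] := eqVneq (pclass n x `&` A k) set0.
    by rewrite measure0 mule_ge0.
  have -> : pclass n x = pclass n y by rewrite /pclass xy.
  by apply: le_trans (Ay n); apply: measureIl; [exact: measurable_pclass|].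
have -> : D = \bigcup_k (D `&` A k).
  rewrite -setI_bigcupr setIidl// => x _.
  have [K xK] := nuK x.
  (* Rounding the constant up to a natural number lets countably many sets [A k] cover [D]. *)
  exists (Num.Def.archi_bound K) => // n; apply: le_trans (xK n) _.
  apply: lee_wpmul2r => //; rewrite lee_fin.
  exact/ltW/unstable.ltr_bound.
apply: measure_negligible.
  by apply: bigcup_measurable => k _; exact: measurableI.
apply: negligible_bigcup => k.
by apply/negligibleP; [exact: measurableI|exact: nuDA].
Qed.

End AbsoluteContinuity.

(** On the part [N] of [D] where the density is nonpositive, its integral [nu N] is at most 0. Hence
    [N] is null for [nu], and then for [mu] by the converse domination on [D]. *)
Lemma Radon_Nikodym_ae_gt0 d (T : measurableType d) (R : realType)
    (nu : {finite_measure set T -> \bar R})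
    (mu : {sigma_finite_measure set T -> \bar R}) (D : set T) :
  measurable D -> nu `<< mu ->
  (forall C, measurable C -> C `<=` D -> nu C = 0%E -> mu C = 0%E) ->
  {ae mu, forall x, D x ->
    (0 < Radon_Nikodym (charge_of_finite_measure nu) mu x)%E}.
Proof.
move=> mD numu munu; set f := Radon_Nikodym _ _.
have fi : mu.-integrable setT f by exact: Radon_Nikodym_integrable.
have mf := measurable_int mu fi.
pose N := D `&` [set x | (f x <= 0)%E].
have mN : measurable N.
  apply: measurableI => //.
  rewrite -[X in measurable X]setTI.
  exact: measurable_realfun.emeasurable_fun_infty_c.
exists N; split=> //.
  apply: munu => //; first by move=> x [].
  apply/eqP; rewrite -measure_le0.
  rewrite -(integral0 mu N).
  rewrite [leLHS](_ : _ = (\int[mu]_(x in N) f x)%E); last first.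
    exact: (@Radon_Nikodym_integral _ _ _ (charge_of_finite_measure nu)).
  apply: le_integral => //; last by move=> x /set_mem[].
  - exact: integrableS fi.
  - exact: integrable0.
by move=> x /not_implyP[Dx /negP]; rewrite -leNgt.
Qed.

(** * The branches and their common left inverse, the shift *)

Section Branches.
Context {B : bratteli}.
Local Notation V := (vert B).
Local Notation E := (edge B).
Local Notation X := (borel_bpath B).
Implicit Types (x y : bpath B) (e : E) (C Q : set X).

(** A zero column of the adjacency matrix would persist in all its positive powers, against
    primitivity. *)
Lemma in_edge (v : V) : exists e : E, rng e = v.
Proof.
have [[|k] // _ /(_ (enum_rank v) (enum_rank v))] := adj_primitive B.
rewrite exprSr mxE => h.
have [j hj] : exists j, (0 < adjmx (@adj B) j (enum_rank v))%N.
  apply/not_existsP => nj; move: h; rewrite big1 // => j _.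
  have := nj j; case: (adjmx _ j _) => [_|n /(_ isT)//]; exact: muln0.
move: hj; rewrite mxE enum_rankK; case hA : adj => // _.
by exists (exist _ (enum_val j, v) hA).
Qed.

(** This is the coding map: it deletes the edge x_1 and restarts with the unique edge from v_0 to
    r(x_1). *)
Definition shift (x : X) : X :=
  @BPath B (rng (ptail x 0%N)) (fun n => ptail x n.+1) (pcompat x 0%N)
    (fun n => pcompat x n.+1).

Lemma DomE e : Dom e = [set y : X | pinit y = rng e].
Proof. by apply/funext => y; rewrite /Dom /= pcompat0. Qed.

Lemma ptail_branch e y : Dom e y -> ptail (branch e y) = prepend e (ptail y).
Proof. by rewrite /branch /Dom /=; case: pselect. Qed.

Lemma pinit_branch e y : Dom e y -> pinit (branch e y) = src e.
Proof. by rewrite /branch /Dom /=; case: pselect. Qed.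

Lemma shift_branch e y : Dom e y -> shift (branch e y) = y.
Proof.
move=> ey; apply: bpath_eq => [|n] /=; rewrite ptail_branch//=.
by move: ey; rewrite DomE => ->.
Qed.

Lemma Ran_branch e y : Dom e y -> Ran e (branch e y).
Proof. by move=> ey; rewrite /Ran /= ptail_branch. Qed.

Lemma Dom_shift e x : Ran e x -> Dom e (shift x).
Proof. by rewrite DomE => /= ->. Qed.

Lemma branch_shift e x : Ran e x -> branch e (shift x) = x.
Proof.
move=> ex; have ey := Dom_shift ex; apply: bpath_eq => [|[|n]].
- by rewrite pinit_branch// (pcompat0 x) ex.
- by rewrite ptail_branch//= ex.
- by rewrite ptail_branch.
Qed.

(** The shift inverts the branch on [Ran e]. Writing images as preimages makes their measurability
    and additivity follow from those of preimages. *)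
Lemma image_branch e C : branch e @` (C `&` Dom e) = shift @^-1` C `&` Ran e.
Proof.
apply/seteqP; split=> [_ [y [Cy ey] <-]|x [/= Cx ex]].
  by split; [rewrite /= shift_branch|exact: Ran_branch].
by exists (shift x); [split=> //; exact: Dom_shift|exact: branch_shift].
Qed.

Lemma pfx_shift n x y : pfx n.+1 x = pfx n.+1 y ->
  pfx n (shift x) = pfx n (shift y).
Proof.
move=> /pfxP[xy1 xy2]; apply/pfxP; split=> [|i ni] /=; first by rewrite xy2.
by rewrite xy2.
Qed.

Lemma pfx_branch e n x y : Dom e x -> Dom e y -> pfx n x = pfx n y ->
  pfx n.+1 (branch e x) = pfx n.+1 (branch e y).
Proof.
move=> ex ey /pfxP[xy1 xy2]; apply/pfxP; rewrite !pinit_branch//.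
by split=> // -[|i] ni; rewrite !ptail_branch//=; exact: xy2.
Qed.

Lemma determined_shift n Q : determined n Q -> determined n.+1 (shift @^-1` Q).
Proof. by move=> dQ x y /pfx_shift; exact: dQ. Qed.

Lemma determined_Dom e : determined 0%N (Dom e).
Proof. by rewrite DomE => x y /pfxP[xy _]; rewrite /= xy. Qed.

Lemma determined_Ran e : determined 1%N (Ran e).
Proof. by move=> x y /pfxP[_ xy]; rewrite /Ran /= xy. Qed.

Lemma measurable_Dom e : measurable (Dom e).
Proof. exact: measurable_determined (@determined_Dom e). Qed.

Lemma measurable_Ran e : measurable (Ran e).
Proof. exact: measurable_determined (@determined_Ran e). Qed.

Lemma measurable_shift : measurable_fun setT shift.
Proof.
apply: measurable_fun_determined => // n Q dQ; rewrite setTI.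
exact: measurable_determined (determined_shift dQ).
Qed.

Lemma measurable_branch e : measurable_fun (Dom e) (branch e).
Proof.
apply: measurable_fun_determined => [|n Q dQ]; first exact: measurable_Dom.
apply: (@measurable_determined _ n) => x y xy [ex Qx].
(* Membership in [Dom e] depends only on the initial vertex, and prepending [e] lengthens a common
   prefix, so [n] edges suffice. *)
have ey : Dom e y by apply: determined_Dom ex; exact: pfx_le xy.
split=> //; apply: dQ Qx; apply: pfx_le (leqnSn n) _; exact: pfx_branch.
Qed.

Lemma image_branch_pclass e n x : Dom e x ->
  shift @^-1` pclass n x `&` Ran e = pclass n.+1 (branch e x).
Proof.
move=> ex; apply/seteqP; split=> [y [/= yx ey]|y yx].
  rewrite /pclass /= -(branch_shift ey); apply: pfx_branch => //.
  exact: Dom_shift.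
split; first by rewrite /pclass /= (pfx_shift yx) shift_branch.
by apply: (@determined_Ran e) (Ran_branch ex); apply: pfx_le (esym yx).
Qed.

End Branches.

(** * The measure transported by a branch, and its density *)

Section BranchMeasure.
Context {R : realType} {B : bratteli}.
Local Notation E := (edge B).
Local Notation X := (borel_bpath B).
Variables (m : probability X R) (e : E).
Implicit Types (x : bpath B) (C : set X).
Local Open Scope ereal_scope.

Lemma measurable_shift_Ran C : measurable C ->
  measurable (shift @^-1` C `&` Ran e).
Proof.
move=> mC; apply: measurableI (measurable_Ran e).
by rewrite -[X in measurable X]setTI; exact: measurable_shift.
Qed.

(** By [image_branch] this is m o sigma_e on [Dom e], extended by 0. *)
Definition branch_measure C : \bar R := m (shift @^-1` C `&` Ran e).

Let branch_measure0 : branch_measure set0 = 0.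
Proof. by rewrite /branch_measure preimage_set0 set0I measure0. Qed.

Let branch_measure_ge0 C : 0 <= branch_measure C.
Proof. exact: measure_ge0. Qed.

Let branch_measure_sigma_additive : semi_sigma_additive branch_measure.
Proof.
move=> F mF tF mU; rewrite /branch_measure preimage_bigcup setI_bigcupl.
apply: measure_semi_sigma_additive.
- by move=> n; exact: measurable_shift_Ran.
- apply: trivIset_setIr; move=> i j _ _ [x [xi xj]].
  by apply: tF => //; exists (shift x).
- by rewrite -setI_bigcupl -preimage_bigcup; exact: measurable_shift_Ran.
Qed.

HB.instance Definition _ := isMeasure.Build _ _ _ branch_measure
  branch_measure0 branch_measure_ge0 branch_measure_sigma_additive.

Let branch_measure_fin : fin_num_fun branch_measure.
Proof. by move=> C mC; apply: fin_num_measure; exact: measurable_shift_Ran. Qed.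

HB.instance Definition _ :=
  Measure_isFinite.Build _ _ _ branch_measure branch_measure_fin.

(* Both inequalities bound the density of [m o sigma_e] with respect to [m]
   along the classes shrinking to [x]. *)
Definition bounded_distortion := forall x, Dom e x -> exists K : R, forall n,
  m (pclass n.+1 (branch e x)) <= K%:E * m (pclass n x) /\
  m (pclass n x) <= K%:E * m (pclass n.+1 (branch e x)).

Hypothesis bd : bounded_distortion.

Lemma branch_measure_pclass n x : Dom e x ->
  branch_measure (pclass n x) = m (pclass n.+1 (branch e x)).
Proof. by move=> ex; rewrite /branch_measure image_branch_pclass. Qed.

Lemma pclass_Dom n x : ~ Dom e x -> pclass n x `&` Dom e = set0.
Proof.
move=> nex; rewrite -subset0 => y [yx ey]; apply: nex.
by apply: determined_Dom ey; exact: pfx_le yx.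
Qed.

Lemma branch_measure_dominates : branch_measure `<< m.
Proof.
apply: dominates_pclass => x.
have [/[dup] ex /bd[K mK]|nex] := pselect (Dom e x).
  by exists K => n; rewrite [leLHS]branch_measure_pclass//; case: (mK n).
(* Outside [Dom e] the whole class misses [Dom e] and has transported measure 0, so the constant 0
   works. *)
exists 0%R => n; rewrite mul0e /= /branch_measure.
rewrite (_ : _ `&` _ = set0) ?measure0//.
by rewrite -image_branch pclass_Dom//; exact: image_set0.
Qed.

Let mDoo : m (Dom e) < +oo.
Proof. by rewrite ltey_eq fin_num_measure//; exact: measurable_Dom. Qed.

(** The transported measure vanishes off [Dom e], so the class criterion is applied to the
    restriction of [m] to [Dom e]. *)
Lemma dominates_branch_measure C : measurable C -> C `<=` Dom e ->
  branch_measure C = 0 -> m C = 0.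
Proof.
move=> mC CD C0.
have : mfrestr (measurable_Dom e) mDoo `<< branch_measure.
  apply: dominates_pclass => x /=; rewrite /mfrestr /mrestr.
  have [/[dup] ex /bd[K mK]|nex] := pselect (Dom e x).
    exists K => n; rewrite branch_measure_pclass//.
    apply: le_trans (mK n).2; apply: measureIl; first exact: measurable_pclass.
    exact: measurable_Dom.
  by exists 0%R => n; rewrite mul0e pclass_Dom// measure0.
move=> /(_ C); rewrite -[in X in _ -> X](setIidl CD); apply => //.
move=> A mA AC; apply/eqP; rewrite -measure_le0 -C0.
by apply: le_measure; rewrite ?inE.
Qed.

Lemma Radon_Nikodym_branch_gt0 : {ae m, forall x, Dom e x ->
  0 < Radon_Nikodym (charge_of_finite_measure branch_measure) m x}.
Proof.
apply: Radon_Nikodym_ae_gt0; first exact: measurable_Dom.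
  exact: branch_measure_dominates.
exact: dominates_branch_measure.
Qed.

End BranchMeasure.

(** * Bounded distortion for Markov measures *)

Section Markov.
Context {R : realType} {B : bratteli}.
Local Notation V := (vert B).
Local Notation E := (edge B).
Local Notation X := (borel_bpath B).
Variable m : probability X R.

(** All ratios in the infinite product equal 1; the denominators are positive because an edge has
    positive weight at its source. *)
Lemma stationary_quasi_stationary :
  stationary_markov m -> quasi_stationary_markov m.
Proof.
move=> [P0 [P [mP stP]]]; exists P0, P; split=> // x; exists 1 => //.
have [[_ _ _ Ppos _] _] := mP.
apply: cvg_near_cst; apply: nearW => n; apply: big1 => i _.
rewrite stP// [P i.+1]stP// divff// gt_eqF//.
exact/Ppos.
Qed.

Lemma markov_measure_pclass P0 P n x : markov_measure m P0 P ->
  m (pclass n x) =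
  (P0 (pinit x) * \prod_(i < n) P i.+1 (src (ptail x i)) (ptail x i))%:E.
Proof.
move=> [_ mP]; rewrite -cylinder_pclass mP; last exact: fpath_pfx.
by congr (_ * _)%:E; apply: eq_bigr => i _; rewrite tnth_mktuple.
Qed.

Lemma cvgn_ubound (u : nat -> R) : cvgn u -> exists M, forall n, u n <= M.
Proof.
move=> /cvg_seq_bounded[M [_ uM]]; exists (M + 1) => n.
by apply: le_trans (ler_norm _) _; apply: (uM (M + 1)) => //; rewrite ltrDl.
Qed.

(** As the limit is positive, the reciprocals converge too, and convergent sequences are bounded. *)
Lemma gt0_cvgn_bounds (r : nat -> R) (l : R) : 0 < l -> r @ \oo --> l ->
  exists K, forall n, r n <= K /\ (r n)^-1 <= K.
Proof.
move=> l0 rl.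
have [M1 rM1] : exists M, forall n, r n <= M by apply: cvgn_ubound (cvgP _ rl).
have [M2 rM2] : exists M, forall n, (r n)^-1 <= M.
  by apply: cvgn_ubound; apply: cvgP (cvgV _ rl); rewrite gt_eqF.
by exists (Num.max M1 M2) => n; rewrite !le_max rM1 rM2 orbT.
Qed.

(** Prepending [e] moves every edge of [x] one level down the diagram, replacing each factor from
    P_i by one from P_(i+1). The quotient of the two measures is thus a partial product [r n] of the
    quasi-stationarity product, times a constant [c]. *)
Lemma quasi_stationary_bounded_distortion e :
  quasi_stationary_markov m -> bounded_distortion m e.
Proof.
move=> [P0 [P [mP qs]]] x ex; have [l l0 rl] := qs x.
have [[P00 _ _ Ppos _] _] := mP.
pose p k i := P k.+1 (src (ptail x i)) (ptail x i).
have p0 k i : 0 < p k i by apply/Ppos.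
pose r n := \prod_(i < n) (p i.+1 i / p i i).
have r0 n : 0 < r n by apply: prodr_gt0 => i _; rewrite divr_gt0.
have [K rK] := gt0_cvgn_bounds l0 rl.
pose c := P0 (src e) * P 1%N (src e) e / P0 (pinit x).
(* The factor [c] accounts for the new initial edge and for [e] itself, relative to the old initial
   edge. *)
have c0 : 0 < c by rewrite !mulr_gt0 ?invr_gt0//; exact/Ppos.
pose a n := P0 (pinit x) * \prod_(i < n) p i i.
have a0 n : 0 < a n by rewrite mulr_gt0// prodr_gt0.
have aE n : m (pclass n x) = (a n)%:E by exact: markov_measure_pclass.
have bE n : m (pclass n.+1 (branch e x)) = (c * r n * a n)%:E.
  rewrite (markov_measure_pclass _ _ mP) pinit_branch// ptail_branch//.
  rewrite big_ord_recl/=.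
  congr (_%:E); rewrite /c /a /r prodf_div.
  have Pn0 : \prod_(i < n) p i i != 0 by rewrite gt_eqF// prodr_gt0.
  rewrite -[\prod_(i < n) P _ _ _]/(\prod_(i < n) p i.+1 i).
  by field; rewrite Pn0 gt_eqF.
exists (Num.max (c * K) (c^-1 * K)) => n; have [rK1 rK2] := rK n.
rewrite aE bE -!EFinM !lee_fin; split.
  by rewrite ler_pM2r// le_max ler_pM2l// rK1.
rewrite mulrA -ler_pdivrMr// divff ?gt_eqF//.
apply: (@le_trans _ _ (c^-1 * (r n)^-1 * (c * r n))).
  by rewrite mulrACA !mulVf ?gt_eqF// mulr1.
rewrite (ler_pM2r (mulr_gt0 c0 (r0 n))).
by rewrite le_max ler_pM2l ?invr_gt0// rK2 orbT.
Qed.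

End Markov.

(** * Bounded distortion for R-invariant measures through vertex weights *)

Section Invariant.
Context {R : realType} {B : bratteli}.
Local Notation V := (vert B).
Local Notation E := (edge B).
Local Notation X := (borel_bpath B).
Implicit Types (v w : V) (es : seq E) (e : E) (n k : nat).

Lemma fend_rcons v es e : fend v (rcons es e) = rng e.
Proof. by rewrite /fend map_rcons last_rcons. Qed.

Lemma fpath_rcons v es e :
  Defs.fpath v (rcons es e) = Defs.fpath v es && (src e == fend v es).
Proof.
elim: es v => [|f es IH] v /=; first by rewrite andbT.
by rewrite IH andbA.
Qed.

(** The path is built backwards from [v] along incoming edges; it shows that every vertex carries a
    weight at every level. *)
Lemma fpath_to n v : exists w es,
  [/\ Defs.fpath w es, size es = n & fend w es = v].
Proof.
elim: n v => [|n IH] v; first by exists v, [::].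
have [e ev] := in_edge v; have [w [es [wes esn we]]] := IH (src e).
exists w, (rcons es e).
by rewrite fpath_rcons wes we eqxx size_rcons esn fend_rcons.
Qed.

Lemma cylinder_src v es (x : bpath B) : cylinder v es x ->
  src (ptail x (size es)) = fend v es.
Proof.
move=> [<- <-]; rewrite size_mkseq; case: (size es) => [|n].
  by rewrite -pcompat0.
by rewrite mkseqS fend_rcons pcompat.
Qed.

Lemma cylinder_rcons v es e :
  cylinder v (rcons es e) = cylinder v es `&` [set x | ptail x (size es) = e].
Proof.
rewrite /cylinder size_rcons; apply/seteqP; split=> x /=; rewrite mkseqS.
  by move=> [xv /rcons_inj[-> ->]].
by move=> [[-> ->] ->].
Qed.

Lemma measurable_cylinder v es : measurable (cylinder v es : set X).
Proof. exact: measurable_determined (@cylinder_determined _ v es). Qed.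

(** The 0-1 condition enters here: an edge is determined by its two endpoints. *)
Lemma sum_edges (F : V -> R) v :
  \sum_(e : E | src e == v) F (rng e) = \sum_(u | adj v u) F u.
Proof.
rewrite (partition_big (@rng B) predT)//= [RHS]big_mkcond/=.
apply: eq_bigr => u _; case: ifPn => [vu|nvu]; last first.
  apply: big_pred0 => -[[v' u'] /= vu']; apply: contraNF nvu.
  by move=> /andP[/eqP <- /eqP <-].
by rewrite (big_pred1 (exist _ (v, u) vu : E)).
Qed.

Variable m : probability X R.
Hypothesis inv : R_invariant m.

Lemma measure_cylinder_split v es : m (cylinder v es) =
  (\sum_(e : E | src e == fend v es) m (cylinder v (rcons es e)))%E.
Proof.
have -> : cylinder v es =
    \bigcup_(e in [set e | src e == fend v es]) cylinder v (rcons es e).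
  apply/seteqP; split=> x; last first.
    by move=> [e _]; rewrite cylinder_rcons => -[].
  move=> xes; exists (ptail x (size es)); first exact/eqP/cylinder_src.
  by rewrite cylinder_rcons.
rewrite measure_fin_bigcup.
- by rewrite (bigfs _ (index_enum_uniq E))// => f _; rewrite mem_index_enum.
- exact: finite_finset.
- by move=> e f _ _ [x []]; rewrite !cylinder_rcons => -[_ /= <-] [_ /= <-].
- by move=> e _; exact: measurable_cylinder.
Qed.

Let vpath n v : V * seq E :=
  let: exist w p := cid (fpath_to n v) in (w, sval (cid p)).

(** Invariance makes the value independent of the chosen path. In Perron-Frobenius terms it is x_v
    λ^(-n). *)
Definition vweight n v : R := fine (m (cylinder (vpath n v).1 (vpath n v).2)).

Lemma cylinder_vweight v es : Defs.fpath v es ->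
  m (cylinder v es) = (vweight (size es) (fend v es))%:E.
Proof.
move=> ves; rewrite /vweight /vpath; case: cid => w p /=.
case: cid => fs /= [wfs sz fw].
rewrite fineK ?fin_num_measure//; last exact: measurable_cylinder.
exact: inv.
Qed.

Lemma vweight_ge0 n v : 0 <= vweight n v.
Proof. exact: fine_ge0. Qed.

(** A cylinder ending at [v] splits according to its next edge; this is the recursion w_n = A
    w_(n+1). *)
Lemma vweightS n v : vweight n v = \sum_(u | adj v u) vweight n.+1 u.
Proof.
have [w [es [wes esn wv]]] := fpath_to n v.
apply/eqP; rewrite -eqe -{1}esn -{1}wv -cylinder_vweight//.
rewrite measure_cylinder_split wv -sum_edges -sumEFin; apply/eqP.
apply: eq_bigr => e /eqP ev.
rewrite cylinder_vweight ?size_rcons ?fend_rcons ?esn//.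
by rewrite fpath_rcons wes wv ev eqxx.
Qed.

Let W n (i : 'I_#|V|) := vweight n (enum_val i).

Lemma vweight_adjmx n i : W n i = \sum_j (adjmx (@adj B) i j)%:R * W n.+1 j.
Proof.
rewrite {1}/W vweightS (reindex_onto (@enum_val V V) enum_rank)/=; last first.
  by move=> *; rewrite enum_rankK.
rewrite big_mkcond; apply: eq_bigr => j _; rewrite mxE enum_valK eqxx andbT.
by case: adj; rewrite ?mul1r ?mul0r.
Qed.

Lemma vweight_adjmxX k n i :
  W n i = \sum_j ((adjmx (@adj B) ^+ k) i j)%:R * W (n + k) j.
Proof.
elim: k i => [|k IH] i.
  rewrite expr0 addn0 (bigD1 i)//= big1 => [|j ji].
    by rewrite mxE eqxx mul1r addr0.
  by rewrite mxE eq_sym (negbTE ji) mul0r.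
rewrite IH; under eq_bigr do rewrite vweight_adjmx mulr_sumr.
rewrite exchange_big/=; apply: eq_bigr => j _.
rewrite exprSr mxE natr_sum mulr_suml addnS.
by apply: eq_bigr => l _; rewrite natrM mulrA.
Qed.

Let W0 n i : 0 <= W n i. Proof. exact: vweight_ge0. Qed.

Let S n := \sum_i W n i.

(* Since [A^k] is positive for some [k], all vertex weights of level [n] are
   comparable with the total weight [S (n + k)]. *)
Lemma vweight_bounds : exists k, exists2 M, 0 <= M &
  forall n i, S (n + k) <= W n i <= M * S (n + k).
Proof.
have [k _ Ak] := adj_primitive B.
(* The sum of all entries of A^k bounds each of them from above, while positivity of these integers
   bounds them below by 1. *)
pose M : R := \sum_i \sum_j ((adjmx (@adj B) ^+ k) i j)%:R.
exists k, M => [|n i]; first by rewrite !sumr_ge0// => *; exact: sumr_ge0.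
rewrite (vweight_adjmxX k) mulr_sumr; apply/andP; split; apply: ler_sum => j _.
  by rewrite ler_peMl// ler1n Ak.
apply: ler_wpM2r => //; rewrite /M (bigD1 i)//= (bigD1 j)//= -addrA lerDl.
by rewrite addr_ge0// sumr_ge0// => *; exact: sumr_ge0.
Qed.

(** Each column of A contains a 1, so every weight of level [n.+1] is counted at least once in
    [S n]. *)
Lemma total_vweight_le n : S n.+1 <= S n.
Proof.
rewrite /S; under [leRHS]eq_bigr do rewrite vweight_adjmx.
rewrite exchange_big/=; apply: ler_sum => j _; rewrite -mulr_suml ler_peMl//.
have [e ej] := in_edge (enum_val j).
rewrite (bigD1 (enum_rank (src e)))//= mxE enum_rankK -ej (valP e) lerDl.
by rewrite sumr_ge0.
Qed.

(** The entries of A are at most 1, so each of the [#|V|] rows contributes at most [S n.+1]. *)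
Lemma total_vweight_ge n : S n <= #|V|%:R * S n.+1.
Proof.
rewrite mulr_natl -[X in _ *+ X]card_ord -sumr_const; apply: ler_sum => i _.
rewrite vweight_adjmx; apply: ler_sum => j _; rewrite mxE.
by case: adj; rewrite ?mul1r ?mul0r.
Qed.

Lemma vweight_comparable : exists K, forall n v w,
  vweight n.+1 v <= K * vweight n w /\ vweight n v <= K * vweight n.+1 w.
Proof.
have [k [M M0 WM]] := vweight_bounds.
(* Both inequalities pass through [S (n + k)] and [S (n + k).+1]. Comparing these totals costs a
   factor 1 in one direction and [#|V|] in the other, and [1 + #|V|] covers both. *)
exists (M * (1 + #|V|%:R)) => n v w.
have {}WM p u : S (p + k) <= vweight p u <= M * S (p + k).
  by have := WM p (enum_rank u); rewrite /W enum_rankK.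
have /andP[Sv vS] := WM n v; have /andP[Sw wS] := WM n w.
have /andP[Sv' vS'] := WM n.+1 v; have /andP[Sw' wS'] := WM n.+1 w.
rewrite addSn in Sv' vS' Sw' wS'; split; rewrite -mulrA.
  apply: le_trans vS' _; apply: ler_wpM2l => //.
  apply: le_trans (total_vweight_le _) _; apply: le_trans Sw _.
  by rewrite ler_peMl ?vweight_ge0// lerDl.
apply: le_trans vS _; apply: ler_wpM2l => //.
apply: le_trans (total_vweight_ge _) _; apply: ler_pM => //.
- exact: sumr_ge0.
- by rewrite lerDr.
Qed.

Lemma R_invariant_bounded_distortion e : bounded_distortion m e.
Proof.
have [K WK] := vweight_comparable; move=> x ex; exists K => n.
rewrite -!cylinder_pclass !cylinder_vweight; try exact: fpath_pfx.
rewrite !size_tuple -!EFinM !lee_fin.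
by split; [exact: (WK n _ _).1|exact: (WK n _ _).2].
Qed.

End Invariant.

(** * Verification of the semibranching axioms, saturation and condition (C-K) *)

Theorem theorem2p19 (R : realType) (B : bratteli)
  (hX : cantor_set (bpath B))
  (m : probability (borel_bpath B) R)
  (hm : nonatomic m)
  (hcase : R_invariant m
           \/ (stationary_markov m /\ full_support m)
           \/ quasi_stationary_markov m) :
  semibranching m (@Dom B) (@Ran B) (@branch B)
  /\ saturated m (@Dom B)
  /\ condition_CK m (@Dom B) (@Ran B).
Proof.
have bd e : bounded_distortion m e.
  case: hcase => [inv|[[st _]|qs]]; first exact: R_invariant_bounded_distortion.
    apply: quasi_stationary_bounded_distortion.
    exact: stationary_quasi_stationary.
  exact: quasi_stationary_bounded_distortion.
split; [split|split].
- exact: hm.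
- exact: measurable_Dom.
- exact: measurable_branch.
- move=> e x y /set_mem ex /set_mem ey /(congr1 shift).
  by rewrite !shift_branch.
- move=> e; have := image_branch e setT.
  by rewrite preimage_setT !setTI => ->.
- move=> e C mC CD; rewrite -(setIidl CD) image_branch.
  exact: measurable_shift_Ran.
- move=> e f ef; rewrite (_ : _ `&` _ = set0) ?measure0// -subset0.
  by move=> x [/= xe xf]; move/eqP: ef; apply; rewrite -xe -xf.
- rewrite (_ : ~` _ = set0) ?measure0// -subset0 => x; apply.
  by exists (ptail x 0%N).
- move=> e; exists (branch_measure m e); split.
  + by move=> C _; rewrite image_branch.
  + exact: branch_measure_dominates.
  + exact: Radon_Nikodym_branch_gt0.
- exists shift; first exact: measurable_shift.
  by move=> e; apply: aeW => x; exact: shift_branch.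
(* Any edge entering the source of x_1 has [x] in its domain. *)
- rewrite /saturated (_ : ~` _ = set0) ?measure0// -subset0 => x; apply.
  by have [e ex] := in_edge (src (ptail x 0%N)); exists e.
(* The index set consists of the edges that can follow [e]; the equality of sets is exact, not only
   up to a null set. *)
- move=> e; exists [set f | src f == rng e]%SET => U.
  have -> : U = Dom e.
    apply/seteqP; split=> [x [f /=]|x ex].
      by rewrite inE => /eqP fe xf; rewrite /Dom /= xf.
    by exists (ptail x 0%N) => //=; rewrite inE; exact/eqP.
  by rewrite setDv measure0.
Qed.
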